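(* Let $\mathbb{T}=(T,\eta,\mu)$ be a monad on a category $\mathcal{C}$ with pullbacks and coequalizers of reflexive pairs, such that these coequalizers are stable under pullback and preserved by $T$. Then every $\mathbb{T}$-functor factors (in $\mathsf{Cat}(\mathbb{T})$) into an initial $\mathbb{T}$-functor followed by a perfect one.
   Context: Composition is written $g\cdot f$ ($f$ first). A pair of parallel morphisms is reflexive if the two morphisms admit a common section. Stability under pullback means: pulling back a coequalizer diagram $X\rightrightarrows Y\to Z$ of a reflexive pair along any morphism $Z'\to Z$ yields again a coequalizer diagram. A $\mathbb{T}$-graph $A=(A_0,A_1,d_0,c_0)$ is a pair of morphisms $d_0:A_1\to TA_0$, $c_0:A_1\to A_0$ in $\mathcal{C}$. A morphism $f=(f_0,f_1):A\to B$ of $\mathbb{T}$-graphs consists of $f_0:A_0\to B_0$, $f_1:A_1\to B_1$ with $d_0^B\cdot f_1=Tf_0\cdot d_0^A$ and $c_0^B\cdot f_1=f_0\cdot c_0^A$. A pointed $\mathbb{T}$-graph $(A,i)$ is a $\mathbb{T}$-graph $A$ with a morphism $i:A_0\to A_1$ such that $d_0\cdot i=\eta_{A_0}$ and $c_0\cdot i=1_{A_0}$. Morphisms of pointed $\mathbb{T}$-graphs are $\mathbb{T}$-graph morphisms $f$ with $f_1\cdot i^A=i^B\cdot f_0$. For a pointed $\mathbb{T}$-graph $(A,i)$, let $A_2$ be the pullback of $Tc_0:TA_1\to TA_0$ and $d_0:A_1\to TA_0$, with projections $d_1:A_2\to TA_1$, $c_1:A_2\to A_1$ (so $Tc_0\cdot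 d_1=d_0\cdot c_1$), and let $A_3$ be the pullback of $Tc_1:TA_2\to TA_1$ and $d_1:A_2\to TA_1$, with projections $d_2:A_3\to TA_2$, $c_2:A_3\to A_2$ (so $Tc_1\cdot d_2=d_1\cdot c_2$). Morphisms $i_1,i_2:A_1\to A_2$ are determined by $d_1\cdot i_1=Ti\cdot d_0$, $c_1\cdot i_1=1_{A_1}$, $d_1\cdot i_2=\eta_{A_1}$, $c_1\cdot i_2=i\cdot c_0$. A $\mathbb{T}$-category $(A,i,m)$ is a pointed $\mathbb{T}$-graph $(A,i)$ with a morphism $m:A_2\to A_1$ such that $d_0\cdot m=\mu_{A_0}\cdot Td_0\cdot d_1$, $c_0\cdot m=c_0\cdot c_1$, $m\cdot i_1=1_{A_1}=m\cdot i_2$, and $m\cdot m_1=m\cdot m_2$, where $m_1,m_2:A_3\to A_2$ are determined by $d_1\cdot m_1=Tm\cdot d_2$, $c_1\cdot m_1=c_1\cdot c_2$, $d_1\cdot m_2=\mu_{A_1}\cdot Td_1\cdot d_2$, $c_1\cdot m_2=m\cdot c_2$. A $\mathbb{T}$-functor $f:A\to B$ is a morphism of pointed $\mathbb{T}$-graphs with $f_1\cdot m^A=m^B\cdot f_2$, where $f_2:A_2\to B_2$ is determined by $d_1^B\cdot f_2=Tf_1\cdot d_1^A$, $c_1^B\cdot f_2=f_1\cdot c_1^A$. $\mathbb{T}$-categories and $\mathbb{T}$-functors form $\mathsf{Cat}(\mathbb{T})$. A $\mathbb{T}$-functor $f:A\to B$ is perfect (a discrete cofibration) if the square $d_0^B\cdot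 f_1=Tf_0\cdot d_0^A$ is a pullback diagram in $\mathcal{C}$, i.e. exhibits $A_1$ as the pullback of $Tf_0:TA_0\to TB_0$ and $d_0^B:B_1\to TB_0$, with projections $d_0^A$ and $f_1$. A $\mathbb{T}$-functor $e:A\to C$ is initial if it is left orthogonal in $\mathsf{Cat}(\mathbb{T})$ to all perfect $\mathbb{T}$-functors: for every perfect $n:D\to E$ and all $\mathbb{T}$-functors $u:A\to D$, $v:C\to E$ with $n\cdot u=v\cdot e$ there is a unique $\mathbb{T}$-functor $w:C\to D$ with $w\cdot e=u$ and $n\cdot w=v$. *)

(* Defs.v *)
From Corelib Require Import ssreflect.
From Stdlib Require Import ProofIrrelevance.

Set Implicit Arguments.
Unset Strict Implicit.
Unset Printing Implicit Defensive.

Record category := Category {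
  ob :> Type;
  hom : ob -> ob -> Type;
  idm : forall a, hom a a;
  comp : forall a b c, hom b c -> hom a b -> hom a c;
  comp_idl : forall a b (f : hom a b), comp (idm b) f = f;
  comp_idr : forall a b (f : hom a b), comp f (idm a) = f;
  compA : forall a b c d (h : hom c d) (g : hom b c) (f : hom a b),
    comp h (comp g f) = comp (comp h g) f }.

Arguments idm {_} _.

Notation "g · f" := (comp g f) (at level 40, left associativity).

Record functor (C D : category) := Functor {
  fobj :> C -> D;
  fmap : forall a b : C, hom a b -> hom (fobj a) (fobj b);
  fmap_id : forall a : C, fmap (idm a) = idm (fobj a);
  fmap_comp : forall (a b c : C) (g : hom b c) (f : hom a b),
    fmap (g · f) = fmap g · fmap f }.

Arguments fmap {_ _} _ {_ _} _.

Record monad (C : category) := Monad {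
  monad_functor :> functor C C;
  eta : forall a : C, hom a (monad_functor a);
  mu : forall a : C, hom (monad_functor (monad_functor a)) (monad_functor a);
  eta_nat : forall (a b : C) (f : hom a b),
    eta b · f = fmap monad_functor f · eta a;
  mu_nat : forall (a b : C) (f : hom a b),
    mu b · fmap monad_functor (fmap monad_functor f)
    = fmap monad_functor f · mu a;
  mu_eta : forall a : C, mu a · eta (monad_functor a) = idm (monad_functor a);
  mu_fmap_eta : forall a : C,
    mu a · fmap monad_functor (eta a) = idm (monad_functor a);
  mu_mu : forall a : C,
    mu a · mu (monad_functor a) = mu a · fmap monad_functor (mu a) }.

Arguments eta {_} _ _.
Arguments mu {_} _ _.

Section Limits.
Variable C : category.

Definition is_pullback (x y z p : C) (f : hom x z) (g : hom y z)
    (p1 : hom p x) (p2 : hom p y) : Prop :=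
  f · p1 = g · p2 /\
  forall (w : C) (u : hom w x) (v : hom w y), f · u = g · v ->
    exists! l : hom w p, p1 · l = u /\ p2 · l = v.

(** A choice of pullbacks: the objects [A_2] and [A_3] attached to a T-graph
    below are the chosen ones. *)
Record pullbacks := Pullbacks {
  pb : forall x y z : C, hom x z -> hom y z -> C;
  pb1 : forall (x y z : C) (f : hom x z) (g : hom y z), hom (pb f g) x;
  pb2 : forall (x y z : C) (f : hom x z) (g : hom y z), hom (pb f g) y;
  pb_lift : forall (x y z : C) (f : hom x z) (g : hom y z)
    (w : C) (u : hom w x) (v : hom w y), f · u = g · v -> hom w (pb f g);
  pb_comm : forall (x y z : C) (f : hom x z) (g : hom y z),
    f · pb1 f g = g · pb2 f g;
  pb1_lift : forall (x y z : C) (f : hom x z) (g : hom y z)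
    (w : C) (u : hom w x) (v : hom w y) (e : f · u = g · v),
    pb1 f g · pb_lift e = u;
  pb2_lift : forall (x y z : C) (f : hom x z) (g : hom y z)
    (w : C) (u : hom w x) (v : hom w y) (e : f · u = g · v),
    pb2 f g · pb_lift e = v;
  pb_ext : forall (x y z : C) (f : hom x z) (g : hom y z)
    (w : C) (h k : hom w (pb f g)),
    pb1 f g · h = pb1 f g · k -> pb2 f g · h = pb2 f g · k -> h = k }.

Lemma pb_is_pullback (P : pullbacks) (x y z : C) (f : hom x z) (g : hom y z) :
  is_pullback f g (pb1 P f g) (pb2 P f g).
Proof.
split; first exact: pb_comm.
move=> w u v e; exists (pb_lift P e); split.
  by split; [exact: pb1_lift | exact: pb2_lift].
move=> l [e1 e2].
by apply: pb_ext; rewrite ?pb1_lift ?pb2_lift.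
Qed.

Definition reflexive_pair (x y : C) (f g : hom x y) : Prop :=
  exists s : hom y x, f · s = idm y /\ g · s = idm y.

Definition is_coequalizer (x y z : C) (f g : hom x y) (q : hom y z) : Prop :=
  q · f = q · g /\
  forall (w : C) (h : hom y w), h · f = h · g -> exists! k : hom z w, k · q = h.

Definition has_reflexive_coequalizers : Prop :=
  forall (x y : C) (f g : hom x y), reflexive_pair f g ->
    exists (z : C) (q : hom y z), is_coequalizer f g q.

(** [x'] and [y'] are the pullbacks of [x -> z] and [y -> z] along [h], and
    [f'], [g'], [q'] are the morphisms induced by [f], [g], [q]. *)
Definition reflexive_coequalizers_stable : Prop :=
  forall (x y z : C) (f g : hom x y) (q : hom y z),
    reflexive_pair f g -> is_coequalizer f g q ->
  forall (z' : C) (h : hom z' z)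
    (y' : C) (hy : hom y' y) (q' : hom y' z')
    (x' : C) (hx : hom x' x) (r' : hom x' z') (f' g' : hom x' y'),
    is_pullback q h hy q' -> is_pullback (q · f) h hx r' ->
    hy · f' = f · hx -> q' · f' = r' ->
    hy · g' = g · hx -> q' · g' = r' ->
    is_coequalizer f' g' q'.

Definition preserves_reflexive_coequalizers (T : functor C C) : Prop :=
  forall (x y z : C) (f g : hom x y) (q : hom y z),
    reflexive_pair f g -> is_coequalizer f g q ->
    is_coequalizer (fmap T f) (fmap T g) (fmap T q).

Definition left_orthogonal (a c d e : C) (l : hom a c) (r : hom d e) : Prop :=
  forall (u : hom a d) (v : hom c e), r · u = v · l ->
    exists! w : hom c d, w · l = u /\ r · w = v.

End Limits.

Section TCategories.
Variables (C : category) (P : pullbacks C) (T : monad C).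

Record tgraph := TGraph {
  G0 : C;
  G1 : C;
  d0 : hom G1 (T G0);
  c0 : hom G1 G0 }.

Record tgraph_hom (A B : tgraph) := TGraphHom {
  map0 : hom (G0 A) (G0 B);
  map1 : hom (G1 A) (G1 B);
  d0_map : d0 B · map1 = fmap T map0 · d0 A;
  c0_map : c0 B · map1 = map0 · c0 A }.

(** [pt] is the morphism [i] of a pointed T-graph; the names [i1] and [i2]
    are kept for the induced morphisms into [A_2]. *)
Record ptgraph := PTGraph {
  ptgraph_graph :> tgraph;
  pt : hom (G0 ptgraph_graph) (G1 ptgraph_graph);
  d0_pt : d0 ptgraph_graph · pt = eta T (G0 ptgraph_graph);
  c0_pt : c0 ptgraph_graph · pt = idm (G0 ptgraph_graph) }.

Record ptgraph_hom (A B : ptgraph) := PTGraphHom {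
  ptgraph_hom_graph :> tgraph_hom A B;
  pt_map : map1 ptgraph_hom_graph · pt A = pt B · map0 ptgraph_hom_graph }.

Section Composable.
Variable A : tgraph.

Definition G2 : C := pb P (fmap T (c0 A)) (d0 A).
Definition d1 : hom G2 (T (G1 A)) := pb1 P (fmap T (c0 A)) (d0 A).
Definition c1 : hom G2 (G1 A) := pb2 P (fmap T (c0 A)) (d0 A).

Lemma d1_c1 : fmap T (c0 A) · d1 = d0 A · c1.
Proof. exact: pb_comm. Qed.

Definition G3 : C := pb P (fmap T c1) d1.
Definition d2 : hom G3 (T G2) := pb1 P (fmap T c1) d1.
Definition c2 : hom G3 G2 := pb2 P (fmap T c1) d1.

Lemma d2_c2 : fmap T c1 · d2 = d1 · c2.
Proof. exact: pb_comm. Qed.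

End Composable.

Section Units.
Variable A : ptgraph.

Lemma i1_comm : fmap T (c0 A) · (fmap T (pt A) · d0 A) = d0 A · idm (G1 A).
Proof. by rewrite compA -fmap_comp c0_pt fmap_id comp_idl comp_idr. Qed.

Definition i1 : hom (G1 A) (G2 A) := pb_lift P i1_comm.

Lemma i2_comm : fmap T (c0 A) · eta T (G1 A) = d0 A · (pt A · c0 A).
Proof. by rewrite compA d0_pt eta_nat. Qed.

Definition i2 : hom (G1 A) (G2 A) := pb_lift P i2_comm.

End Units.

Section Multiplication.
Variables (A : tgraph) (m : hom (G2 A) (G1 A)).
Hypothesis d0_m : d0 A · m = mu T (G0 A) · fmap T (d0 A) · d1 A.
Hypothesis c0_m : c0 A · m = c0 A · c1 A.

Lemma m1_comm :
  fmap T (c0 A) · (fmap T m · d2 A) = d0 A · (c1 A · c2 A).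
Proof.
by rewrite !compA -fmap_comp c0_m fmap_comp -compA d2_c2 compA d1_c1.
Qed.

Definition m1 : hom (G3 A) (G2 A) := pb_lift P m1_comm.

Lemma m2_comm :
  fmap T (c0 A) · (mu T (G1 A) · fmap T (d1 A) · d2 A) = d0 A · (m · c2 A).
Proof.
rewrite [RHS]compA d0_m -[RHS]compA -d2_c2 !compA -mu_nat.
rewrite -(compA (mu T _) (fmap T (fmap T _))) -fmap_comp d1_c1 fmap_comp.
by rewrite !compA.
Qed.

Definition m2 : hom (G3 A) (G2 A) := pb_lift P m2_comm.

End Multiplication.

(** [mul] is the morphism [m]. *)
Record tcat := TCat {
  tcat_ptgraph :> ptgraph;
  mul : hom (G2 tcat_ptgraph) (G1 tcat_ptgraph);
  d0_mul : d0 tcat_ptgraph · mul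
    = mu T (G0 tcat_ptgraph) · fmap T (d0 tcat_ptgraph) · d1 tcat_ptgraph;
  c0_mul : c0 tcat_ptgraph · mul = c0 tcat_ptgraph · c1 tcat_ptgraph;
  mul_i1 : mul · i1 tcat_ptgraph = idm (G1 tcat_ptgraph);
  mul_i2 : mul · i2 tcat_ptgraph = idm (G1 tcat_ptgraph);
  mul_m1_m2 : mul · m1 c0_mul = mul · m2 d0_mul }.

Lemma map2_comm (A B : tgraph) (f : tgraph_hom A B) :
  fmap T (c0 B) · (fmap T (map1 f) · d1 A) = d0 B · (map1 f · c1 A).
Proof.
by rewrite !compA -fmap_comp c0_map d0_map fmap_comp -!compA d1_c1.
Qed.

Definition map2 (A B : tgraph) (f : tgraph_hom A B) : hom (G2 A) (G2 B) :=
  pb_lift P (map2_comm f).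

Record tfunctor (A B : tcat) := TFunctor {
  tfunctor_hom :> ptgraph_hom A B;
  map_mul : map1 tfunctor_hom · mul A = mul B · map2 tfunctor_hom }.

Lemma tgraph_hom_eq (A B : tgraph) (f g : tgraph_hom A B) :
  map0 f = map0 g -> map1 f = map1 g -> f = g.
Proof.
case: f g => [f0 f1 df cf] [g0 g1 dg cg] /= e0 e1; subst g0 g1.
by rewrite (proof_irrelevance _ df dg) (proof_irrelevance _ cf cg).
Qed.

Lemma tfunctor_eq (A B : tcat) (f g : tfunctor A B) :
  map0 f = map0 g -> map1 f = map1 g -> f = g.
Proof.
move=> e0 e1; have := tgraph_hom_eq e0 e1.
case: f g {e0 e1} => [[f fi] fm] [[g gi] gm] /= e; subst g.
have e := proof_irrelevance _ fi gi; subst gi.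
by rewrite (proof_irrelevance _ fm gm).
Qed.

(** Proof irrelevance makes equality of T-functors equality of their
    components, so that [Cat] is a category for Leibniz equality. *)
Definition tgraph_id (A : tgraph) : tgraph_hom A A.
Proof.
apply: (@TGraphHom A A (idm (G0 A)) (idm (G1 A))).
- by rewrite fmap_id comp_idl comp_idr.
- by rewrite comp_idl comp_idr.
Defined.

Definition tgraph_comp (A B D : tgraph) (g : tgraph_hom B D)
  (f : tgraph_hom A B) : tgraph_hom A D.
Proof.
apply: (@TGraphHom A D (map0 g · map0 f) (map1 g · map1 f)).
- by rewrite compA d0_map fmap_comp -!compA d0_map.
- by rewrite compA c0_map -!compA c0_map.
Defined.

Lemma map2_id (A : tgraph) : map2 (tgraph_id A) = idm (G2 A).
Proof.
apply: pb_ext; rewrite ?pb1_lift ?pb2_lift comp_idr /=.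
- by rewrite fmap_id comp_idl.
- by rewrite comp_idl.
Qed.

Lemma map2_comp (A B D : tgraph) (g : tgraph_hom B D) (f : tgraph_hom A B) :
  map2 (tgraph_comp g f) = map2 g · map2 f.
Proof.
apply: pb_ext; rewrite compA ?pb1_lift ?pb2_lift -[RHS]compA
  ?pb1_lift ?pb2_lift compA //=.
by rewrite fmap_comp.
Qed.

Definition tfunctor_id (A : tcat) : tfunctor A A.
Proof.
unshelve refine (@TFunctor A A (@PTGraphHom A A (tgraph_id A) _) _).
- by rewrite /= comp_idl comp_idr.
- by rewrite /= map2_id comp_idl comp_idr.
Defined.

Definition tfunctor_comp (A B D : tcat) (g : tfunctor B D) (f : tfunctor A B) :
  tfunctor A D.
Proof.
unshelve refine (@TFunctor A D (@PTGraphHom A D (tgraph_comp g f) _) _).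
- by rewrite /= -compA pt_map compA pt_map compA.
- by rewrite /= map2_comp -compA map_mul compA map_mul compA.
Defined.

Definition Cat : category.
Proof.
apply: (@Category tcat tfunctor tfunctor_id tfunctor_comp).
- by move=> A B f; apply: tfunctor_eq; rewrite /= comp_idl.
- by move=> A B f; apply: tfunctor_eq; rewrite /= comp_idr.
- by move=> A B D E h g f; apply: tfunctor_eq; rewrite /= compA.
Defined.

Definition perfect (A B : Cat) (f : hom A B) : Prop :=
  is_pullback (fmap T (map0 (f : tfunctor A B))) (d0 (B : tcat))
    (d0 (A : tcat)) (map1 (f : tfunctor A B)).

Definition initial (A D : Cat) (e : hom A D) : Prop :=
  forall (E F : Cat) (n : hom E F), perfect n -> left_orthogonal e n.

End TCategories.

(* Main.v *)
From Corelib Require Import ssreflect.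
Require Import Defs.

Set Implicit Arguments.
Unset Strict Implicit.
Unset Printing Implicit Defensive.

(** Write [T X x B_1] for the pullback of [T n_0 : T X -> T B_0] and
    [d_0 : B_1 -> T B_0], where [n_0 : X -> B_0].  Assigning this object, with
    the map [c_0] to [B_0], to [(X, n_0)] is a monad on the slice category over
    [B_0], for every T-category [B]: its unit is [(eta, i n_0)] and its
    multiplication is given by [mu] and [m].  A perfect T-functor [D -> B] is
    the same thing as an algebra [xi : T X x B_1 -> X] of this monad, with
    [X = D_0], [D_1 = T X x B_1] and [xi = c_0]; the multiplication of [D] is
    forced because [D_1] is a pullback ([action_tcat], [perfect_action]).

    A T-functor [f : A -> B] then factors through the algebra that is universal
    among those receiving a map [a] from [A_0] with [a c_0] equal to the action
    of [A_1] on [a].  It is a coequalizer, in algebras, of two maps between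
    the free algebras [T A_1 x B_1] and [T A_0 x B_1]; one applies [T c_0], the
    other lets [A_1] act through [f_1] and [m].  The pair is reflexive because
    [A] has units.  As [T] and pullback preserve its coequalizer [q] in
    the base category, [T q] pulled back along [d_0] is again a coequalizer, so
    that the free action descends along [q] ([quotient_action_exists]); doing
    this twice yields the epimorphism which tests associativity
    ([quotient_action_mul]).

    Initiality of [e : A -> D] is read off from [D] alone: it suffices that
    [c_0 pi_2 : T A_0 x D_1 -> D_0] be the coequalizer just described, with [D]
    in place of [B] ([initial_of_coequalizer]).  Indeed, a square from [e] to a
    perfect [n : E -> F] sends [T A_0 x D_1] to [E_1], because [E_1] is a
    pullback, and then by [c_0] to [E_0]; this map descends to [D_0].  Pulling
    [T] of the coequalizer back along [d_0] gives a cover of [D_1], on which the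
    result is seen to be compatible with [c_0], hence to be a T-functor.  Since
    [T A_0 x D_1 = T A_0 x B_1] by cancellation of pullbacks, the criterion
    applies to the [D] constructed from [f].

    The functor [T] need not preserve pullbacks, so nothing is ever said about
    [T] of a pullback except through its projections.  All computations are
    made with products [m (x, y)] of generalized elements [x : W -> T A_1] and
    [y : W -> A_1] with [T c_0 x = d_0 y]. *)

(** * Pullbacks and coequalizers *)

Section Category.
Variable C : category.

Lemma coequalizer_epi (x y z w : C) (f g : hom x y) (q : hom y z)
    (h k : hom z w) :
  is_coequalizer f g q -> h · q = k · q -> h = k.
Proof.
move=> [qfg univ] hk.
have [|l [_ lU]] := univ w (h · q); first by rewrite -!compA qfg.
by rewrite -(lU h) // -(lU k).
Qed.

Lemma pullback_ext (x y z p w : C) (f : hom x z) (g : hom y z)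
    (p1 : hom p x) (p2 : hom p y) (h k : hom w p) :
  is_pullback f g p1 p2 -> p1 · h = p1 · k -> p2 · h = p2 · k -> h = k.
Proof.
move=> [comm univ] h1 h2.
have [|l [_ lU]] := univ w (p1 · h) (p2 · h); first by rewrite !compA comm.
by rewrite -(lU h) // -(lU k).
Qed.

Lemma pullback_left_cancel (x y z w p r : C) (f1 : hom x y) (f2 : hom y z)
    (g : hom w z) (p1 : hom p y) (p2 : hom p w) (r1 : hom r x) (r2 : hom r w)
    (l : hom r p) :
  is_pullback f2 g p1 p2 -> is_pullback (f2 · f1) g r1 r2 ->
  p1 · l = f1 · r1 -> p2 · l = r2 -> is_pullback f1 p1 r1 l.
Proof.
move=> pbp pbr l1 l2; split=> // v a b ab.
have [|k [[k1 k2] kU]] := proj2 pbr v a (p2 · b).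
  by rewrite -compA ab !compA (proj1 pbp).
exists k; split=> [|k' [k1' k2']].
  split=> //; apply: (pullback_ext pbp); first by rewrite compA l1 -compA k1.
  by rewrite compA l2.
by apply: kU; rewrite -k2' compA l2.
Qed.

End Category.

Section BaseChange.
Variables (C : category) (P : pullbacks C) (T : monad C).
Hypothesis stable : reflexive_coequalizers_stable C.
Hypothesis preserved : preserves_reflexive_coequalizers T.

Local Notation "# f" := (fmap T f) (at level 30).

(** The base change is along a map into [T z], as the morphisms to be covered
    ([d_0] and [d_1]) have such codomains.  Reflexivity is part of the
    conclusion, so that the lemma can be applied to its own output. *)
Lemma base_change_coequalizer (x y z w : C) (f g : hom x y) (q : hom y z)
    (h : hom w (T z)) :
  reflexive_pair f g -> is_coequalizer f g q ->
  exists (r : C) (t : hom r (T x)) (f' g' : hom r (pb P (#q) h)),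
    pb1 P (#q) h · f' = #f · t /\ pb1 P (#q) h · g' = #g · t /\
    reflexive_pair f' g' /\ is_coequalizer f' g' (pb2 P (#q) h).
Proof.
move=> refl coeq; have [s [fs gs]] := refl.
have qfg : #q · #g = #q · #f by rewrite -!fmap_comp (proj1 coeq).
pose t := pb1 P (#q · #f) h; pose b := pb2 P (#q · #f) h.
have ef : #q · (#f · t) = h · b by rewrite compA pb_comm.
have eg : #q · (#g · t) = h · b by rewrite compA qfg pb_comm.
have es : #q · #f · (#s · pb1 P (#q) h) = h · pb2 P (#q) h.
  by rewrite compA -(compA (#q)) -fmap_comp fs fmap_id comp_idr pb_comm.
exists (pb P (#q · #f) h), t, (pb_lift P ef), (pb_lift P eg).
split; [|split; [|split]]; rewrite ?pb1_lift //.
  exists (pb_lift P es); split; apply: pb_ext.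
  by rewrite compA !pb1_lift -compA pb1_lift compA -fmap_comp fs fmap_id
    comp_idl comp_idr.
  by rewrite compA !pb2_lift comp_idr.
  by rewrite compA !pb1_lift -compA pb1_lift compA -fmap_comp gs fmap_id
    comp_idl comp_idr.
  by rewrite compA !pb2_lift comp_idr.
have refl' : reflexive_pair (#f) (#g).
  by exists (#s); rewrite -!fmap_comp fs gs fmap_id.
apply: (stable refl' (preserved refl coeq) (h := h) (hy := pb1 P (#q) h)
   (hx := t) (r' := b)); rewrite ?pb1_lift ?pb2_lift //; exact: pb_is_pullback.
Qed.

End BaseChange.

(** * Multiplication of generalized elements *)

Section Elements.
Variables (C : category) (P : pullbacks C) (T : monad C).

Local Notation "# f" := (fmap T f) (at level 30).

Section Multiplication.
Variable A : tcat P T.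

(** The proof [h] is an index of the product; by [gmul_ext] its choice is
    immaterial. *)
Definition gmul (w : C) (x : hom w (T (G1 A))) (y : hom w (G1 A))
  (h : #(c0 A) · x = d0 A · y) : hom w (G1 A) := mul A · pb_lift P h.

Lemma gmul_comp (v w : C) x y (h : #(c0 A) · x = d0 A · y) (k : hom v w)
    x' y' (h' : #(c0 A) · x' = d0 A · y') :
  x · k = x' -> y · k = y' -> gmul h · k = gmul h'.
Proof.
move=> ex ey; rewrite /gmul -compA; congr (_ · _).
by apply: pb_ext; rewrite compA ?pb1_lift ?pb2_lift.
Qed.

Lemma gmul_ext (w : C) (x x' : hom w _) y y' (h : #(c0 A) · x = d0 A · y)
    (h' : #(c0 A) · x' = d0 A · y') :
  x = x' -> y = y' -> gmul h = gmul h'.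
Proof. by move=> ? ?; rewrite -[LHS]comp_idr; apply: gmul_comp; rewrite comp_idr. Qed.

Lemma d0_gmul (w : C) (x : hom w _) y (h : #(c0 A) · x = d0 A · y) :
  d0 A · gmul h = mu T (G0 A) · (#(d0 A) · x).
Proof. by rewrite /gmul compA d0_mul -!compA pb1_lift. Qed.

Lemma c0_gmul (w : C) (x : hom w _) y (h : #(c0 A) · x = d0 A · y) :
  c0 A · gmul h = c0 A · y.
Proof. by rewrite /gmul compA c0_mul -!compA pb2_lift. Qed.

Lemma gmul_pt_l (w : C) (x : hom w _) y z (h : #(c0 A) · x = d0 A · z) :
  x = #(pt A) · (d0 A · y) -> z = y -> gmul h = y.
Proof.
move=> ex ez; rewrite -[RHS]comp_idl -(mul_i1 A) /gmul -compA; congr (_ · _).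
by apply: pb_ext; rewrite [RHS]compA ?pb1_lift ?pb2_lift ?comp_idl // -compA.
Qed.

Lemma gmul_pt_r (w : C) (x : hom w _) y z (h : #(c0 A) · x = d0 A · z) :
  x = eta T _ · y -> z = pt A · (c0 A · y) -> gmul h = y.
Proof.
move=> ex ez; rewrite -[RHS]comp_idl -(mul_i2 A) /gmul -compA; congr (_ · _).
by apply: pb_ext; rewrite [RHS]compA ?pb1_lift ?pb2_lift // -compA.
Qed.

Lemma gmulA_comm (v w : C) (x : hom w (T (G1 A))) (y : hom w (G1 A))
    (h : #(c0 A) · x = d0 A · y) (s : hom v (T w)) (z : hom v (G1 A))
    (h2 : #(c0 A) · (#y · s) = d0 A · z) :
  #(c0 A) · (mu T _ · (#x · s)) = d0 A · gmul h2.
Proof.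
by rewrite d0_gmul !compA -mu_nat -!(compA (mu T _)) -!fmap_comp h.
Qed.

(** As [T] need not preserve the pullback [A_2], a composable pair under [T] has
    to be given as [T] of a pair [(x, y)] evaluated at some [s]; this is what
    makes [(s, z)] define an element of [A_3]. *)
Lemma gmulA (v w : C) (x : hom w (T (G1 A))) (y : hom w (G1 A))
    (h : #(c0 A) · x = d0 A · y) (s : hom v (T w)) (z : hom v (G1 A))
    (h1 : #(c0 A) · (#(gmul h) · s) = d0 A · z)
    (h2 : #(c0 A) · (#y · s) = d0 A · z)
    (h3 : #(c0 A) · (mu T _ · (#x · s)) = d0 A · gmul h2) :
  gmul h1 = gmul h3.
Proof.
have e2 : d1 P A · pb_lift P h2 = #y · s by exact: pb1_lift.
have e3 : #(c1 P A) · (#(pb_lift P h) · s) = d1 P A · pb_lift P h2.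
  by rewrite e2 compA -fmap_comp pb2_lift.
pose k := pb_lift P e3.
have k1 : d2 P A · k = #(pb_lift P h) · s by exact: pb1_lift.
have k2 : c2 P A · k = pb_lift P h2 by exact: pb2_lift.
have -> : gmul h1 = mul A · (m1 (c0_mul A) · k).
  rewrite /gmul; congr (_ · _); apply: pb_ext.
    by rewrite compA !pb1_lift -compA k1 compA -fmap_comp.
  by rewrite compA !pb2_lift -compA k2 pb2_lift.
rewrite compA mul_m1_m2 -compA /gmul; congr (_ · _); apply: pb_ext.
  rewrite [RHS]pb1_lift [LHS]compA pb1_lift -!compA k1 [#(d1 P A) · _]compA -fmap_comp.
  by rewrite pb1_lift.
by rewrite [RHS]pb2_lift compA pb2_lift -compA k2.
Qed.

End Multiplication.

Lemma map1_gmul_comm (A B : tcat P T) (f : tfunctor A B) (w : C) (x : hom w _) y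
    (h : #(c0 A) · x = d0 A · y) :
  #(c0 B) · (#(map1 f) · x) = d0 B · (map1 f · y).
Proof.
by rewrite !compA -fmap_comp c0_map d0_map fmap_comp -!compA h.
Qed.

Lemma map1_gmul (A B : tcat P T) (f : tfunctor A B) (w : C) (x : hom w _) y
    (h : #(c0 A) · x = d0 A · y) :
  map1 f · gmul h = gmul (map1_gmul_comm f h).
Proof.
rewrite /gmul compA map_mul -compA; congr (_ · _).
by apply: pb_ext; rewrite compA !(pb1_lift, pb2_lift) -compA
  !(pb1_lift, pb2_lift).
Qed.

(** * Perfect T-functors *)

Lemma perfect_ext (E F : tcat P T) (n : tfunctor E F) (w : C)
    (h k : hom w (G1 E)) :
  @perfect C P T E F n -> d0 E · h = d0 E · k -> map1 n · h = map1 n · k ->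
  h = k.
Proof. exact: pullback_ext. Qed.

(** As [E_1] is a pullback, [w1] is forced by [w0] and [v], and the laws on
    units and multiplication hold because they hold after projecting to [F] and
    to [T E_0].  Compatibility with [c_0] is the only real condition. *)
Lemma lift_along_perfect (D E F : tcat P T) (n : tfunctor E F)
    (v : tfunctor D F) (w0 : hom (G0 D) (G0 E)) (w1 : hom (G1 D) (G1 E)) :
  @perfect C P T E F n -> map0 n · w0 = map0 v ->
  d0 E · w1 = #w0 · d0 D -> map1 n · w1 = map1 v -> c0 E · w1 = w0 · c0 D ->
  exists w : tfunctor D E, map0 w = w0 /\ map1 w = w1.
Proof.
move=> pn nw0 dw nw1 cw.
pose w := TGraphHom dw cw.
have wpt : map1 w · pt D = pt E · map0 w.
  apply: (perfect_ext pn) => /=.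
    by rewrite !compA dw d0_pt -compA d0_pt eta_nat.
  by rewrite !compA nw1 !pt_map -compA nw0.
have wmul : map1 w · mul D = mul E · map2 P w.
  apply: (perfect_ext pn) => /=.
    rewrite !compA dw d0_mul -!compA d0_mul /map2 -!compA pb1_lift /=.
    rewrite !compA -mu_nat -!compA; congr (_ · _).
    by rewrite !compA -!fmap_comp dw.
  rewrite !compA nw1 !map_mul -compA; congr (_ · _).
  apply: pb_ext; rewrite compA !(pb1_lift, pb2_lift) -?compA
    !(pb1_lift, pb2_lift) /= compA ?nw1 //.
  by rewrite -fmap_comp nw1.
by exists (@TFunctor _ _ _ D E (PTGraphHom wpt) wmul).
Qed.


(** * A criterion for initiality *)

Section Initiality.
Hypothesis stable : reflexive_coequalizers_stable C.
Hypothesis preserved : preserves_reflexive_coequalizers T.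

(** [p0] stands for [T A_0 x D_1], and [y], [x2 · s] are the components of
    a map from [p1] to [T A_1 x D_1].  On elements, [s] sends [(a, d)] to
    [(T c_0 a, d)] and [t] sends it to [(mu (T d_0 a), m (T e_1 a, d))]. *)
Lemma initial_of_coequalizer (A D : tcat P T) (e : tfunctor A D) (p0 p1 : C)
    (x1 : hom p0 (T (G0 A))) (x2 : hom p0 (G1 D))
    (s t : hom p1 p0) (y : hom p1 (T (G1 A)))
    (h : #(c0 D) · (#(map1 e) · y) = d0 D · (x2 · s)) :
  is_pullback (#(map0 e)) (d0 D) x1 x2 ->
  x1 · s = #(c0 A) · y ->
  x1 · t = mu T _ · (#(d0 A) · y) -> x2 · t = gmul h ->
  reflexive_pair s t -> is_coequalizer s t (c0 D · x2) ->
  @initial C P T A D e.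
Proof.
move=> pb0 xs xt1 xt2 refl coeq E F n pn u v nu.
have nu0 : map0 n · map0 u = map0 v · map0 e.
  exact: (f_equal (fun k : tfunctor A F => map0 k) nu).
have nu1 : map1 n · map1 u = map1 v · map1 e.
  exact: (f_equal (fun k : tfunctor A F => map1 k) nu).
have x12 : #(map0 e) · x1 = d0 D · x2 by exact: (proj1 pb0).
have [|phi [[phi1 phi2] _]] := proj2 pn p0 (#(map0 u) · x1) (map1 v · x2).
  by rewrite !compA -fmap_comp nu0 fmap_comp d0_map -!compA x12.
(* In E, the image of [t (a, d)] is the product of [T u_1 a] with the image of
   [s (a, d)], and [c_0] of a product is [c_0] of its right factor. *)
have phi_st : c0 E · phi · s = c0 E · phi · t.
  have hs : #(c0 E) · (#(map1 u) · y) = d0 E · (phi · s).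
    by rewrite !compA phi1 -!compA xs !compA -!fmap_comp c0_map.
  have -> : c0 E · phi · t = c0 E · gmul hs.
    rewrite -compA; congr (_ · _); apply: (perfect_ext pn).
      rewrite compA phi1 d0_gmul -compA xt1 !compA -mu_nat.
      by congr (_ · _); rewrite -!compA -!fmap_comp d0_map.
    rewrite compA phi2 -compA xt2 !map1_gmul.
    apply: gmul_ext; last by rewrite !compA phi2.
    by rewrite !compA -!fmap_comp nu1.
  by rewrite c0_gmul compA.
have [w0 [w0q w0U]] := proj2 coeq _ _ phi_st.
have w0e : w0 · map0 e = map0 u.
  (* The unit [(eta, i e_0)] is a section of [c_0 pi_2] over [e_0]. *)
  have [|j [[j1 j2] _]] := proj2 pb0 (G0 A) (eta T _) (pt D · map0 e).
    by rewrite compA d0_pt eta_nat.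
  have -> : map0 e = c0 D · x2 · j by rewrite -compA j2 compA c0_pt comp_idl.
  rewrite compA w0q -compA.
  have -> : phi · j = pt E · map0 u.
    apply: (perfect_ext pn).
      by rewrite !compA phi1 -compA j1 d0_pt eta_nat.
    by rewrite !compA phi2 -compA j2 compA !pt_map -!compA nu0.
  by rewrite compA c0_pt comp_idl.
have nw0 : map0 n · w0 = map0 v.
  apply: (coequalizer_epi coeq).
  by rewrite -compA w0q compA -c0_map -compA phi2 compA c0_map compA.
have [|w1 [[w1d w1n] _]] := proj2 pn (G1 D) (#w0 · d0 D) (map1 v).
  by rewrite compA -fmap_comp nw0 d0_map.
(* The equation may be checked on [T p0 x D_1], a cover of [D_1]: both sides
   become [c_0] of a triple product. *)
have w1c : c0 E · w1 = w0 · c0 D.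
  have [r' [z [f' [g' [_ [_ [_ coeq']]]]]]] :=
    base_change_coequalizer P stable preserved (d0 D) refl coeq.
  apply: (coequalizer_epi coeq').
  pose r1 := pb1 P (#(c0 D · x2)) (d0 D).
  set r2 := pb2 P _ _ in coeq' *.
  have r12 : #(c0 D · x2) · r1 = d0 D · r2 by exact: pb_comm.
  have hw : #(c0 E) · (#phi · r1) = d0 E · (w1 · r2).
    by rewrite !compA w1d -!compA -r12 !compA -!fmap_comp w0q.
  have hD : #(c0 D) · (#x2 · r1) = d0 D · r2.
    by rewrite -r12 compA -fmap_comp.
  have [|l [[l1 l2] _]] := proj2 pb0 _ (mu T _ · (#x1 · r1)) (gmul hD).
    by rewrite d0_gmul !compA -mu_nat -!(compA (mu T _)) -!fmap_comp x12.
  have -> : w0 · c0 D · r2 = c0 E · phi · l.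
    by rewrite -w0q -!compA l2 c0_gmul.
  rewrite -!compA -[LHS](c0_gmul hw); congr (_ · _); apply: (perfect_ext pn).
    rewrite d0_gmul [RHS]compA phi1 -compA l1 !compA -mu_nat.
    by rewrite -!(compA (mu T _)) -!fmap_comp phi1.
  rewrite [RHS]compA phi2 -compA l2 !map1_gmul.
  apply: gmul_ext; first by rewrite !compA -!fmap_comp phi2.
  by rewrite compA w1n.
have [w [ew0 ew1]] := lift_along_perfect pn nw0 w1d w1n w1c.
have nw : tfunctor_comp n w = v.
  by apply: tfunctor_eq; rewrite /= ?ew0 ?ew1.
exists w; split.
  split=> //; apply: tfunctor_eq; rewrite /= ?ew0 ?ew1 //.
  apply: (perfect_ext pn).
    by rewrite compA w1d -compA d0_map compA -fmap_comp w0e d0_map.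
  by rewrite compA w1n nu1.
move=> w' [w'e nw'].
have w'e0 : map0 (w' : tfunctor D E) · map0 e = map0 u.
  exact: (f_equal (fun k : tfunctor A E => map0 k) w'e).
have nw'1 : map1 n · map1 (w' : tfunctor D E) = map1 v.
  exact: (f_equal (fun k : tfunctor D F => map1 k) nw').
have ew0' : w0 = map0 (w' : tfunctor D E).
  apply: w0U; rewrite compA -c0_map -compA; congr (_ · _).
  apply: (perfect_ext pn).
    by rewrite compA d0_map phi1 -compA -x12 compA -fmap_comp w'e0.
  by rewrite compA nw'1.
apply: tfunctor_eq; first by rewrite ew0.
rewrite ew1; apply: (perfect_ext pn); last by rewrite w1n nw'1.
by rewrite w1d d0_map ew0'.
Qed.

End Initiality.

(** * Perfect T-functors from actions *)

Section Action.
Variables (B : tcat P T) (X : C) (n0 : hom X (G0 B)).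

Local Notation p := (pb1 P (#n0) (d0 B)).
Local Notation b := (pb2 P (#n0) (d0 B)).

Lemma action_pt_comm : #n0 · eta T X = d0 B · (pt B · n0).
Proof. by rewrite compA d0_pt eta_nat. Qed.

Definition action_pt : hom X (pb P (#n0) (d0 B)) := pb_lift P action_pt_comm.

Variable xi : hom (pb P (#n0) (d0 B)) X.

(** An action gives a T-graph with [d_0] and [c_0] the two maps out of
    [T X x B_1]. *)
Definition action_graph : tgraph T := TGraph p xi.

Hypothesis n0_xi : n0 · xi = c0 B · b.

Lemma d0_action : d0 B · b = #n0 · d0 action_graph.
Proof. by rewrite pb_comm. Qed.

Lemma c0_action : c0 B · b = n0 · c0 action_graph.
Proof. by rewrite -n0_xi. Qed.

Definition action_graph_hom : tgraph_hom action_graph B :=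
  @TGraphHom _ _ action_graph B n0 b d0_action c0_action.

Lemma action_mul_comm :
  #n0 · (mu T X · #p · d1 P action_graph)
  = d0 B · (mul B · map2 P action_graph_hom).
Proof.
rewrite [RHS]compA d0_mul -[RHS]compA /map2 pb1_lift /= !compA -mu_nat.
by rewrite -!(compA (mu T _)) -!fmap_comp pb_comm.
Qed.

Definition action_mul : hom (G2 P action_graph) (pb P (#n0) (d0 B)) :=
  pb_lift P action_mul_comm.

Lemma d0_action_mul : p · action_mul = mu T X · #p · d1 P action_graph.
Proof. exact: pb1_lift. Qed.

Lemma b_action_mul_comm (w : C) (k : hom w (G2 P action_graph)) :
  #(c0 B) · (#b · (d1 P action_graph · k)) = d0 B · (b · (c1 P action_graph · k)).
Proof.
rewrite !compA -fmap_comp -n0_xi fmap_comp -pb_comm; congr (_ · _).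
by rewrite -!compA; congr (_ · _); exact: (d1_c1 P action_graph).
Qed.

Lemma b_action_mul (w : C) (k : hom w (G2 P action_graph)) :
  b · (action_mul · k) = gmul (b_action_mul_comm k).
Proof.
rewrite compA pb2_lift -compA /gmul; congr (_ · _).
by apply: pb_ext; rewrite compA !(pb1_lift, pb2_lift) compA.
Qed.

Hypothesis xi_pt : xi · action_pt = idm X.
Hypothesis xi_mul : xi · action_mul = xi · c1 P action_graph.

Definition action_ptgraph : ptgraph T :=
  @PTGraph _ _ action_graph action_pt (pb1_lift _ _) xi_pt.

Lemma action_mul_i1 : action_mul · i1 P action_ptgraph = idm _.
Proof.
apply: pb_ext; rewrite comp_idr.
  rewrite compA d0_action_mul -compA pb1_lift /= !compA -(compA (mu T X)).
  by rewrite -fmap_comp pb1_lift mu_fmap_eta comp_idl.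
rewrite b_action_mul.
apply: gmul_pt_l; last by rewrite pb2_lift comp_idr.
by rewrite [d1 _ _ · _]pb1_lift [RHS]compA [LHS]compA -[in LHS]fmap_comp
  [in LHS]pb2_lift fmap_comp -!compA -pb_comm.
Qed.

Lemma action_mul_i2 : action_mul · i2 P action_ptgraph = idm _.
Proof.
apply: pb_ext; rewrite comp_idr.
  rewrite compA d0_action_mul -compA pb1_lift -compA -eta_nat compA mu_eta.
  by rewrite comp_idl.
rewrite b_action_mul; apply: gmul_pt_r.
  by rewrite pb1_lift eta_nat.
by rewrite pb2_lift !compA pb2_lift -!compA /= n0_xi.
Qed.

(** The first component of [action_mul] is governed by the monad laws of T,
    the second one by associativity in [B]. *)
Lemma action_mul_assoc :
  action_mul · m1 (A := action_graph) xi_mul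
  = action_mul · m2 (A := action_graph) d0_action_mul.
Proof.
apply: pb_ext.
  rewrite !compA d0_action_mul -!compA !pb1_lift /= !compA.
  rewrite -!(compA (mu T X)) -!fmap_comp d0_action_mul.
  by rewrite !fmap_comp !compA -mu_mu -!compA; congr (_ · _);
    rewrite !compA mu_nat.
rewrite !b_action_mul.
have h2 : #(c0 B) · (#(b · c1 P action_graph) · d2 P action_graph)
    = d0 B · (b · (c1 P action_graph · c2 P action_graph)).
  by rewrite -b_action_mul_comm fmap_comp -d2_c2 !compA.
have eb : b · (action_mul · c2 P action_graph) = gmul h2.
  rewrite b_action_mul; apply: gmul_ext => //.
  by rewrite -d2_c2 fmap_comp compA.
have h : #(c0 B) · (#b · d1 P action_graph) = d0 B · (b · c1 P action_graph).
  by have := b_action_mul_comm (idm _); rewrite !comp_idr.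
have eam : b · action_mul = gmul h.
  rewrite -[action_mul]comp_idr b_action_mul.
  by apply: gmul_ext; rewrite comp_idr.
have d1m1 : d1 P action_graph · m1 (A := action_graph) xi_mul
    = #action_mul · d2 P action_graph by exact: pb1_lift.
have h1 : #(c0 B) · (#(gmul h) · d2 P action_graph)
    = d0 B · (b · (c1 P action_graph · c2 P action_graph)).
  by rewrite -eam fmap_comp -compA -d1m1 b_action_mul_comm pb2_lift.
have h3 : #(c0 B) · (mu T _ · (#(#b · d1 P action_graph) · d2 P action_graph))
    = d0 B · gmul h2.
  exact: gmulA_comm h _ _ _.
transitivity (gmul h1).
  apply: gmul_ext; last by rewrite pb2_lift.
  by rewrite d1m1 -eam fmap_comp compA.
rewrite (gmulA h1 h3); apply: gmul_ext; last by rewrite pb2_lift.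
by rewrite pb1_lift fmap_comp !compA mu_nat.
Qed.

Definition action_tcat : tcat P T :=
  @TCat _ _ _ action_ptgraph action_mul d0_action_mul xi_mul action_mul_i1
    action_mul_i2 action_mul_assoc.

Definition action_tfunctor : tfunctor action_tcat B.
Proof.
unshelve refine (@TFunctor _ _ _ action_tcat B
  (@PTGraphHom _ _ action_tcat B action_graph_hom _) _).
- exact: pb2_lift.
- exact: pb2_lift.
Defined.

Lemma perfect_action : @perfect C P T action_tcat B action_tfunctor.
Proof. exact: pb_is_pullback. Qed.

End Action.

(** * The factorization *)

Section Factorization.
Hypothesis stable : reflexive_coequalizers_stable C.
Hypothesis preserved : preserves_reflexive_coequalizers T.
Variables (A B : tcat P T) (f : tfunctor A B).

(** [free0] and [free1] are the free actions of [B] on [A_0] and on [A_1], where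
    [A_1] lies over [B_0] by [f_0 c_0]. *)
Definition free0 : C := pb P (#(map0 f)) (d0 B).
Definition free1 : C := pb P (#(map0 f · c0 A)) (d0 B).

Local Notation x1 := (pb1 P (#(map0 f)) (d0 B)).
Local Notation x2 := (pb2 P (#(map0 f)) (d0 B)).
Local Notation y1 := (pb1 P (#(map0 f · c0 A)) (d0 B)).
Local Notation y2 := (pb2 P (#(map0 f · c0 A)) (d0 B)).

Lemma rel_src_comm : #(map0 f) · (#(c0 A) · y1) = d0 B · y2.
Proof. by rewrite compA -fmap_comp pb_comm. Qed.

Definition rel_src : hom free1 free0 := pb_lift P rel_src_comm.

Lemma rel_gmul_comm : #(c0 B) · (#(map1 f) · y1) = d0 B · y2.
Proof. by rewrite compA -fmap_comp c0_map pb_comm. Qed.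

Lemma rel_tgt_comm :
  #(map0 f) · (mu T _ · (#(d0 A) · y1)) = d0 B · gmul rel_gmul_comm.
Proof.
by rewrite d0_gmul !compA -mu_nat -!(compA (mu T _)) -!fmap_comp d0_map.
Qed.

(** On elements, [(a, b)] goes to [(mu (T d_0 a), m (T f_1 a, b))]: the morphism
    of algebras which extends [(d_0, f_1) : A_1 -> free0]. *)
Definition rel_tgt : hom free1 free0 := pb_lift P rel_tgt_comm.

Lemma rel_reflexive : reflexive_pair rel_src rel_tgt.
Proof.
have h : #(map0 f · c0 A) · (#(pt A) · x1) = d0 B · x2.
  by rewrite compA -fmap_comp -compA c0_pt comp_idr pb_comm.
exists (pb_lift P h); split; apply: pb_ext; rewrite comp_idr compA.
  rewrite pb1_lift -compA pb1_lift compA -fmap_comp c0_pt fmap_id.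
  by rewrite comp_idl.
  by rewrite !pb2_lift.
  rewrite pb1_lift -!compA pb1_lift (compA (#(d0 A))) -fmap_comp d0_pt compA.
  by rewrite mu_fmap_eta comp_idl.
rewrite pb2_lift.
have h' : #(c0 B) · (#(map1 f) · (#(pt A) · x1)) = d0 B · x2.
  by rewrite compA -fmap_comp c0_map.
transitivity (gmul h').
  by apply: gmul_comp; rewrite -?compA ?pb1_lift ?pb2_lift.
apply: gmul_pt_l => //.
by rewrite compA -fmap_comp pt_map fmap_comp -compA pb_comm.
Qed.

(** Hence the coequalizer of the pair lies over [B_0]. *)
Lemma rel_over : c0 B · x2 · rel_src = c0 B · x2 · rel_tgt.
Proof. by rewrite -!compA !pb2_lift c0_gmul. Qed.

Variables (X : C) (q : hom free0 X).
Hypothesis q_coeq : is_coequalizer rel_src rel_tgt q.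
Variable n0 : hom X (G0 B).
Hypothesis n0_q : n0 · q = c0 B · x2.

Local Notation D1 := (pb P (#n0) (d0 B)).
Local Notation p := (pb1 P (#n0) (d0 B)).
Local Notation b := (pb2 P (#n0) (d0 B)).

(** [xi] is induced by the free action [(z, b) |-> (mu (T x1 z), m (T x2 z, b))] on
    [free0]: if [(z, b k)] represents [k], then its product [l] represents
    [xi · k].  The quantification over [z], [k], [l] makes this usable for
    arbitrary generalized elements. *)
Definition is_quotient_action (xi : hom D1 X) : Prop :=
  forall (w : C) (z : hom w (T free0)) (k : hom w D1) (l : hom w free0)
    (h : #(c0 B) · (#x2 · z) = d0 B · (b · k)),
  #q · z = p · k -> x1 · l = mu T _ · (#x1 · z) -> x2 · l = gmul h ->
  xi · k = q · l.

Lemma quotient_action_comm (w : C) (z : hom w (T free0)) (k : hom w D1) :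
  #q · z = p · k -> #(c0 B) · (#x2 · z) = d0 B · (b · k).
Proof.
move=> e; rewrite !compA -fmap_comp -n0_q fmap_comp -pb_comm -!compA.
by rewrite e.
Qed.

Lemma free_action_comm (w : C) (z : hom w (T free0)) (v : hom w (G1 B))
    (h : #(c0 B) · (#x2 · z) = d0 B · v) :
  #(map0 f) · (mu T _ · (#x1 · z)) = d0 B · gmul h.
Proof.
by rewrite d0_gmul !compA -mu_nat -!(compA (mu T _)) -!fmap_comp pb_comm.
Qed.

(** [D_1] is the coequalizer of the base changes of [T rel_src] and
    [T rel_tgt]. The free action respects these because both [rel_src] and
    [rel_tgt] are morphisms from the free action on [A_1]: this is formal for
    the former, and associativity in [B] for the latter. *)
Lemma quotient_action_exists : exists xi : hom D1 X, is_quotient_action xi.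
Proof.
have [r [z [f' [g' [zf [zg [_ coeq']]]]]]] :=
  base_change_coequalizer P stable preserved p rel_reflexive q_coeq.
pose r1 := pb1 P (#q) p; set r2 := pb2 P (#q) p in coeq' *.
have hM : #(c0 B) · (#x2 · r1) = d0 B · (b · r2).
  by apply: quotient_action_comm; exact: pb_comm.
pose M := pb_lift P (free_action_comm hM).
have qM : q · M · f' = q · M · g'.
  have r2e : r2 · f' = r2 · g' by exact: (proj1 coeq').
  have hy : #(c0 B) · (#y2 · z) = d0 B · (b · (r2 · f')).
    rewrite [b · _]compA [RHS]compA -hM -!compA zf; congr (_ · _).
    by rewrite compA -fmap_comp pb2_lift.
  have hl : #(map0 f · c0 A) · (mu T _ · (#y1 · z)) = d0 B · gmul hy.
    by rewrite d0_gmul !compA -mu_nat -!(compA (mu T _)) -!fmap_comp pb_comm.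
  pose M' := pb_lift P hl.
  (* [M] is the free action on [A_0], [M'] the one on [A_1]. *)
  have Mf : M · f' = rel_src · M'.
    apply: pb_ext; rewrite !compA.
      rewrite !pb1_lift -!compA pb1_lift zf !compA -!mu_nat.
      by rewrite -!(compA (mu T _)) -!fmap_comp pb1_lift.
    rewrite !pb2_lift; apply: gmul_comp; last by rewrite compA.
    by rewrite -compA zf compA -fmap_comp pb2_lift.
  have Mg : M · g' = rel_tgt · M'.
    have hg : #(c0 B) · (#(gmul rel_gmul_comm) · z) = d0 B · (b · (r2 · f')).
      by rewrite compA -fmap_comp c0_gmul -hy compA -fmap_comp.
    have hM' : #(c0 B) · (mu T _ · (#(#(map1 f) · y1) · z)) = d0 B · gmul hy.
      exact: gmulA_comm rel_gmul_comm _ _ _.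
    apply: pb_ext; rewrite !compA.
      rewrite !pb1_lift -!compA pb1_lift zg (compA (#x1)) -fmap_comp pb1_lift.
      rewrite (fmap_comp _ (mu T _)) (fmap_comp _ (#(d0 A))) !compA -mu_mu.
      by rewrite -(compA (mu T _)) mu_nat !compA.
    rewrite !pb2_lift; transitivity (gmul hg).
      apply: gmul_comp; last by rewrite -compA r2e.
      by rewrite -compA zg compA -fmap_comp pb2_lift.
    rewrite (gmulA hg hM'); symmetry; apply: gmul_comp.
      by rewrite -!compA pb1_lift (fmap_comp _ (#(map1 f))) !compA mu_nat.
    by rewrite pb2_lift.
  by rewrite -!compA Mf Mg (compA q) (proj1 q_coeq) compA.
have [xi [xir _]] := proj2 coeq' _ _ qM.
exists xi => w u k l h uk l1 l2.
pose s := pb_lift P uk.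
have -> : k = r2 · s by rewrite pb2_lift.
rewrite compA xir -compA; congr (_ · _); apply: pb_ext.
  by rewrite l1 [LHS]compA pb1_lift -!compA pb1_lift.
by rewrite l2 [LHS]compA pb2_lift; apply: gmul_comp;
  rewrite -compA ?pb1_lift ?pb2_lift.
Qed.

Section Action.
Variable xi : hom D1 X.
Hypothesis xi_quot : is_quotient_action xi.

Lemma quotient_action_over : n0 · xi = c0 B · b.
Proof.
have [r [z [f' [g' [_ [_ [_ coeq']]]]]]] :=
  base_change_coequalizer P stable preserved p rel_reflexive q_coeq.
apply: (coequalizer_epi coeq').
have e : #q · pb1 P (#q) p = p · pb2 P (#q) p by exact: pb_comm.
pose h := quotient_action_comm e.
have := xi_quot (l := pb_lift P (free_action_comm h)) (h := h) e.
rewrite pb1_lift pb2_lift -compA => -> //.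
by rewrite compA n0_q -!compA pb2_lift c0_gmul.
Qed.

Lemma quotient_action_pt : xi · action_pt n0 = idm X.
Proof.
apply: (coequalizer_epi q_coeq); rewrite comp_idl -compA -[RHS]comp_idr.
have e : #q · eta T _ = p · (action_pt n0 · q).
  by rewrite -eta_nat compA pb1_lift.
apply: (xi_quot (h := quotient_action_comm e) e); rewrite comp_idr.
  by rewrite -eta_nat compA mu_eta comp_idl.
symmetry; apply: gmul_pt_r; first by rewrite eta_nat.
by rewrite compA pb2_lift -compA n0_q.
Qed.

(** [D_2] is covered by the base change along [d_1] of [T] of the cover of
    [D_1] by [T free0 x D_1].  On this second cover the equation is
    associativity of the free action. *)
Lemma quotient_action_mul :
  xi · action_mul quotient_action_over = xi · c1 P (action_graph xi).
Proof.
have [r [z [f' [g' [_ [_ [refl' coeq']]]]]]] :=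
  base_change_coequalizer P stable preserved p rel_reflexive q_coeq.
have [? [? [? [? [_ [_ [_ coeq2]]]]]]] :=
  base_change_coequalizer P stable preserved (d1 P (action_graph xi)) refl' coeq'.
apply: (coequalizer_epi coeq2); rewrite -!compA.
pose r1 := pb1 P (#q) p; set r2 := pb2 P (#q) p.
have er : #q · r1 = p · r2 by exact: pb_comm.
pose g := action_graph xi.
pose sg := pb1 P (#r2) (d1 P g); set tu := pb2 P (#r2) (d1 P g).
have st : #r2 · sg = d1 P g · tu by exact: pb_comm.
have hr := quotient_action_comm er; pose M := pb_lift P (free_action_comm hr).
have xir : xi · r2 = q · M.
  by apply: (xi_quot (h := hr) er); rewrite ?pb1_lift ?pb2_lift.
have e1 : #q · (#M · sg) = p · (c1 P g · tu).
  by rewrite [RHS]compA -d1_c1 -compA -st !compA -!fmap_comp xir.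
have h1 := quotient_action_comm e1; pose l := pb_lift P (free_action_comm h1).
have e2 : #q · (mu T _ · (#r1 · sg)) = p · (action_mul quotient_action_over · tu).
  rewrite [RHS]compA d0_action_mul -[RHS]compA -st !compA -mu_nat.
  by rewrite -!(compA (mu T _)) -!fmap_comp er.
have h2 := quotient_action_comm e2.
rewrite (xi_quot (l := l) (h := h1) e1) ?pb1_lift ?pb2_lift //.
apply: (xi_quot (h := h2) e2); rewrite ?pb1_lift ?pb2_lift.
  rewrite (compA (#x1)) -fmap_comp pb1_lift (fmap_comp _ (mu T _)).
  rewrite (fmap_comp _ (#x1)) !compA -mu_mu.
  by rewrite -(compA (mu T _) (mu T _)) mu_nat !compA.
have h3 : #(c0 B) · (#(gmul hr) · sg) = d0 B · (b · (c1 P g · tu)).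
  by rewrite -h1 (compA (#x2)) -fmap_comp pb2_lift.
have h4 : #(c0 B) · (#(b · r2) · sg) = d0 B · (b · (c1 P g · tu)).
  by rewrite fmap_comp -compA st (b_action_mul_comm quotient_action_over).
have h5 := gmulA_comm hr h4.
transitivity (gmul h3).
  by apply: gmul_ext => //; rewrite compA -fmap_comp pb2_lift.
rewrite (gmulA h3 h5); apply: gmul_ext.
  by rewrite (fmap_comp _ (#x2)) !compA mu_nat.
by rewrite b_action_mul; apply: gmul_ext => //; rewrite fmap_comp -compA st.
Qed.

Lemma unit0_comm : #(map0 f) · eta T _ = d0 B · (pt B · map0 f).
Proof. by rewrite compA d0_pt eta_nat. Qed.

(** The object part of [e : A -> D]: the unit of the free algebra followed by
    the quotient map. *)
Definition unit0 : hom (G0 A) X := q · pb_lift P unit0_comm.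

Lemma n0_unit0 : n0 · unit0 = map0 f.
Proof. by rewrite compA n0_q -compA pb2_lift compA c0_pt comp_idl. Qed.

(** The action of [D] on the images of objects of [A] is represented by [q].
    This gives compatibility of [e] with [c_0], and identifies [q] with the map
    [c_0 pi_2] of the criterion for initiality. *)
Lemma quotient_action_unit0 (w : C) (k : hom w D1) (l : hom w free0) :
  p · k = #unit0 · (x1 · l) -> b · k = x2 · l -> xi · k = q · l.
Proof.
move=> k1 k2.
have e : #q · (#(pb_lift P unit0_comm) · (x1 · l)) = p · k.
  by rewrite k1 fmap_comp -[RHS]compA.
apply: (xi_quot (h := quotient_action_comm e) e).
  rewrite !(compA (#x1)) -fmap_comp pb1_lift.
  by rewrite (compA (mu T _)) mu_fmap_eta comp_idl.
symmetry; apply: gmul_pt_l => //.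
rewrite (compA (#x2)) -fmap_comp pb2_lift fmap_comp.
by rewrite (compA (d0 B)) -pb_comm !compA.
Qed.

Lemma unit1_comm : #n0 · (#unit0 · d0 A) = d0 B · map1 f.
Proof. by rewrite compA -fmap_comp n0_unit0 d0_map. Qed.

(** With [x = (eta, i f_0 c_0)] in [free1], the left side is [q · rel_tgt · x]
    and the right side is [q · rel_src · x]. *)
Lemma c0_unit1 : xi · pb_lift P unit1_comm = unit0 · c0 A.
Proof.
have h : #(map0 f) · d0 A = d0 B · map1 f by rewrite d0_map.
rewrite (quotient_action_unit0 (l := pb_lift P h)) ?pb1_lift ?pb2_lift //.
have hx : #(map0 f · c0 A) · eta T _ = d0 B · (pt B · (map0 f · c0 A)).
  by rewrite compA d0_pt eta_nat.
have -> : pb_lift P h = rel_tgt · pb_lift P hx.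
  apply: pb_ext; rewrite [RHS]compA ?pb1_lift ?pb2_lift.
    by rewrite -!compA pb1_lift -eta_nat compA mu_eta comp_idl.
  have hg : #(c0 B) · (#(map1 f) · eta T _) = d0 B · (pt B · (map0 f · c0 A)).
    by rewrite compA -fmap_comp c0_map.
  transitivity (gmul hg); last first.
    by symmetry; apply: gmul_comp; rewrite -?compA ?pb1_lift ?pb2_lift.
  by symmetry; apply: gmul_pt_r; rewrite ?eta_nat // c0_map.
rewrite compA -(proj1 q_coeq) -!compA; congr (_ · _).
apply: pb_ext; rewrite [LHS]compA [RHS]compA ?pb1_lift ?pb2_lift.
  by rewrite -compA pb1_lift eta_nat.
by rewrite compA.
Qed.

Lemma factorization : exists (E : tcat P T) (e : tfunctor A E) (n : tfunctor E B),
  @initial C P T A E e /\ @perfect C P T E B n /\ tfunctor_comp n e = f.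
Proof.
pose D : tcat P T := action_tcat quotient_action_pt quotient_action_mul.
pose n : tfunctor D B := action_tfunctor quotient_action_pt quotient_action_mul.
have pn : @perfect C P T D B n by exact: perfect_action.
pose e1' : hom (G1 A) (G1 D) := pb_lift P unit1_comm.
have d0e : d0 D · e1' = #unit0 · d0 A by exact: pb1_lift.
have ne : map1 n · e1' = map1 f by exact: pb2_lift.
have [e [e0 e1]] := lift_along_perfect (v := f) pn n0_unit0 d0e ne c0_unit1.
exists D, e, n; split; last first.
  split=> //; apply: tfunctor_eq.
    by rewrite [LHS](_ : _ = map0 n · map0 e) // e0; exact: n0_unit0.
  by rewrite [LHS](_ : _ = map1 n · map1 e) // e1.
have hx : #n0 · (#unit0 · x1) = d0 B · x2.
  by rewrite compA -fmap_comp n0_unit0 pb_comm.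
pose x2' := pb_lift P hx.
have x2'q : xi · x2' = q.
  rewrite -[RHS]comp_idr; apply: quotient_action_unit0; rewrite comp_idr.
    exact: pb1_lift.
  exact: pb2_lift.
have h : #(c0 D) · (#(map1 e) · y1) = d0 D · (x2' · rel_src).
  rewrite [RHS]compA [d0 D · _]pb1_lift -[RHS]compA pb1_lift.
  by rewrite !compA -!fmap_comp c0_map e0.
(* [T A_0 x D_1] and [T A_0 x B_1] are the same pullback, by cancellation. *)
apply: (@initial_of_coequalizer stable preserved A D e free0 free1 x1 x2'
  rel_src rel_tgt y1 h).
- rewrite e0; apply: pullback_left_cancel (pb_is_pullback P (#n0) (d0 B)) _ _ _.
  + by rewrite -fmap_comp n0_unit0; exact: pb_is_pullback.
  + exact: pb1_lift.
  + exact: pb2_lift.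
- exact: pb1_lift.
- exact: pb1_lift.
- apply: (perfect_ext pn).
    rewrite d0_gmul [LHS]compA [d0 D · _]pb1_lift -[LHS]compA pb1_lift.
    rewrite !compA -mu_nat -!(compA (mu T _)) -!fmap_comp d0_map e0.
    by rewrite !fmap_comp !compA.
  rewrite map1_gmul [LHS]compA [map1 n · _]pb2_lift pb2_lift.
  apply: gmul_ext.
    by rewrite e1 compA -fmap_comp [map1 n · _]pb2_lift.
  by rewrite [RHS]compA [map1 n · _]pb2_lift pb2_lift.
- exact: rel_reflexive.
- by rewrite [c0 D · _]x2'q.
Qed.

End Action.
End Factorization.
End Elements.

Theorem theorem6p3 (C : category) (P : pullbacks C) (T : monad C)
  (coeqs : has_reflexive_coequalizers C)
  (stable : reflexive_coequalizers_stable C)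
  (preserved : preserves_reflexive_coequalizers T)
  (A B : Cat P T) (f : hom A B) :
  exists (D : Cat P T) (e : hom A D) (n : hom D B),
    initial e /\ perfect n /\ n · e = f.
Proof.
have [X [q q_coeq]] := coeqs _ _ _ _ (rel_reflexive f).
have [n0 [n0_q _]] := proj2 q_coeq _ _ (rel_over f).
have [xi xi_quot] := quotient_action_exists stable preserved q_coeq n0_q.
exact: (factorization stable preserved q_coeq n0_q xi_quot).
Qed.
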